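(* Let $U(\vec{\theta})$ be a one-dimensional alternating-layered hardware efficient ansatz (HEA) of depth $D$ on $n$ qubits, let $|\psi\rangle$ be an $n$-qubit pure state, and let $O=\sum_{i}c_iP_i$ with $P_i$ Pauli operators and $c_i\in\mathbb{R}$. Let $f(\vec{\theta})=\mathrm{Tr}[U(\vec{\theta})|\psi\rangle\langle\psi|U^{\dagger}(\vec{\theta})O]$ and $f_{trv}=2^{-n}\mathrm{Tr}[O]$. For each $i$ let $\Lambda_i:=\operatorname{supp}(U^{\dagger}(\vec{\theta})P_iU(\vec{\theta}))$. Then $$|f(\vec{\theta})-f_{trv}|\le \sum_i |c_i|\,\mathcal{I}_{\Lambda_i}(\psi),$$ and moreover $\sum_i|c_i|\le (3n)^{\max_i|\operatorname{supp}(P_i)|}\|O\|_\infty$. Letting $\Lambda$ denote a largest of the sets $\Lambda_i$, its size satisfies $$|\Lambda|\le 2D\cdot \max_i|\operatorname{supp}(P_i)|.$$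
   Context: Qubits are arranged on a line with nearest-neighbour couplings. A one-dimensional alternating-layered HEA of depth $D$ is a circuit $U(\vec\theta)$ consisting of $D$ layers; in each layer two-qubit (parametrized) gates act on disjoint pairs of neighbouring qubits $(j,j+1)$, and the pairings alternate between consecutive layers in a brick-like pattern. Parametrized gates are of the form $e^{-i\theta_l H_l}V_l$ with $H_l$ traceless Pauli operators and $V_l$ fixed unitaries. The support $\operatorname{supp}(X)$ of an operator is the set of qubits on which it acts non-trivially. For a subset $\Lambda$ of qubits, $\psi_\Lambda=\mathrm{Tr}_{\bar\Lambda}[|\psi\rangle\langle\psi|]$ is the reduced state and $\mathcal{I}_{\Lambda}(\psi):=\left\|\psi_\Lambda-\frac{\mathbb{1}_\Lambda}{2^{|\Lambda|}}\right\|_1$ (trace norm). $\|\cdot\|_\infty$ is the operator norm.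
   Formalization: The depth D is assumed to be at least 1 (for D = 0 the bound on |Λ| fails), and the Pauli operators P_i in O are taken pairwise distinct (with repetitions, e.g. O = X − X, the bound on the sum of |c_i| fails). *)

(* Defs.v *)
From HB Require Import structures.
From mathcomp Require Import all_boot all_order all_algebra.
From mathcomp Require Import spectral.
From mathcomp Require Import complex.
From mathcomp Require Import reals.

Set Implicit Arguments.
Unset Strict Implicit.
Unset Printing Implicit Defensive.

Import Order.TTheory GRing.Theory Num.Theory.
Local Open Scope ring_scope.
Local Open Scope sesquilinear_scope.

Section Quantum.
Variable C : numClosedFieldType.

Definition ent (T : finType) (A : 'M[C]_#|T|) (x y : T) : C :=
  A (enum_rank x) (enum_rank y).
Definition mxF (T : finType) (f : T -> T -> C) : 'M[C]_#|T| :=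
  \matrix_(i, j) f (enum_val i) (enum_val j).

Definition dag m n (A : 'M[C]_(m, n)) : 'M[C]_(n, m) := A ^t*.

(* Trace norm ||A||_1 = Tr sqrt(A^dag A) = sum of the square roots of the
   eigenvalues (with multiplicity) of A^dag A. *)
Definition trnorm m (A : 'M[C]_m) : C :=
  \sum_(i < m) sqrtC (spectral_diag (dag A *m A) 0 i).
Definition opnorm m (A : 'M[C]_m) : C :=
  \big[Num.max/0]_(i < m) sqrtC (spectral_diag (dag A *m A) 0 i).

(* computational basis states of n qubits *)
Definition cfg (n : nat) := {ffun 'I_n -> bool}.
Definition flip n (q : 'I_n) (x : cfg n) : cfg n :=
  [ffun r => if r == q then ~~ x r else x r].

(* A acts trivially on qubit q, i.e. A = 1_q (x) A' *)
Definition trivial_on n (A : 'M[C]_#|cfg n|) (q : 'I_n) : bool :=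
  [forall x : cfg n, [forall y : cfg n,
     ent A x y == (if x q == y q then ent A (flip q x) (flip q y) else 0)]].
Definition opsupp n (A : 'M[C]_#|cfg n|) : {set 'I_n} :=
  [set q | ~~ trivial_on A q].

(* 0 = I, 1 = X, 2 = Y, 3 = Z *)
Definition sigma (a : 'I_4) (b b' : bool) : C :=
  match val a with
  | 0 => (b == b')%:R
  | 1 => (b != b')%:R
  | 2 => if b == b' then 0 else if b then 'i else - 'i
  | _ => if b == b' then (if b then -1 else 1) else 0
  end.
Definition pstring (n : nat) := {ffun 'I_n -> 'I_4}.
Definition pauli n (P : pstring n) : 'M[C]_#|cfg n| :=
  mxF (fun x y : cfg n => \prod_(q < n) sigma (P q) (x q) (y q)).

Definition gate := 'M[C]_#|{: bool * bool}|.

Definition embed2 n (j k : 'I_n) (G : gate) : 'M[C]_#|cfg n| :=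
  mxF (fun x y : cfg n =>
    ([forall q : 'I_n, ((q != j) && (q != k)) ==> (x q == y q)])%:R
    * ent G (x j, x k) (y j, y k)).

Definition nxt n (j : 'I_n) : 'I_n :=
  if insub (j.+1) is Some k then k else j.

Definition layer n D (p : bool) (G : 'I_D -> 'I_n -> gate) (l : 'I_D)
  : 'M[C]_#|cfg n| :=
  foldr (fun (j : 'I_n) acc =>
          if (j.+1 < n)%N && ~~ odd (j + l + p)
          then embed2 j (nxt j) (G l j) *m acc else acc)
        1%:M (enum 'I_n).

(* U = L_{D-1} ... L_1 L_0 *)
Definition hea n D (p : bool) (G : 'I_D -> 'I_n -> gate) : 'M[C]_#|cfg n| :=
  foldr (fun (l : 'I_D) acc => acc *m layer p G l) 1%:M (enum 'I_D).

Definition scfg n (L : {set 'I_n}) := {ffun {q : 'I_n | q \in L} -> bool}.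
Definition restr n (L : {set 'I_n}) (x : cfg n) : scfg L :=
  [ffun q => x (val q)].

Definition ptrace n (L : {set 'I_n}) (A : 'M[C]_#|cfg n|) : 'M[C]_#|scfg L| :=
  mxF (fun a b : scfg L =>
    \sum_(x : cfg n) \sum_(y : cfg n)
      ((restr L x == a) && (restr L y == b)
        && [forall q : 'I_n, (q \notin L) ==> (x q == y q)])%:R * ent A x y).

Definition infoI n (L : {set 'I_n}) (rho : 'M[C]_#|cfg n|) : C :=
  trnorm (ptrace L rho - ((2 ^ #|L|)%:R)^-1 *: 1%:M).

End Quantum.

(* Main.v *)
Require Import Defs.
From HB Require Import structures.
From mathcomp Require Import all_boot all_order all_algebra.
From mathcomp Require Import spectral complex reals.
From mathcomp Require Import sesquilinear zify ring.

Import Order.TTheory GRing.Theory Num.Theory.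
Local Open Scope ring_scope.

Set Implicit Arguments.
Unset Strict Implicit.
Unset Printing Implicit Defensive.

(* In the Heisenberg picture f is the sum of c_P tr(rho Q_P), Q_P = U^* P U.
   As Q_P is a unitary supported on Lam P, the deviation from tr Q_P / 2^n is the
   trace of a unitary on Lam P against rho_Lam - 1/2^|Lam|, hence at most its
   trace norm.  For the coefficients, orthogonality of the Pauli strings bounds
   sum |c_P|^2 by |O|_oo^2; Cauchy-Schwarz then costs the square root of the
   number of strings, which is at most (4n)^k <= ((3n)^k)^2.  Conjugating by a
   gate preserves the property "supported in L" when L contains both or none of
   its qubits, and the brick pattern gives such sets L growing by one qubit on
   each side per layer. *)

(** * Matrices indexed by a finite type, read entrywise *)

Section Entries.
Variables (C : numClosedFieldType) (T : finType).
Implicit Types (A B : 'M[C]_#|T|) (x y : T).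

Lemma ent_mxF (f : T -> T -> C) x y : ent (mxF f) x y = f x y.
Proof. by rewrite /ent mxE !enum_rankK. Qed.

Lemma ent_inj A B : (forall x y, ent A x y = ent B x y) -> A = B.
Proof.
move=> AB; apply/matrixP => i j.
by have := AB (enum_val i) (enum_val j); rewrite /ent !enum_valK.
Qed.

Lemma ent_mul A B x y : ent (A *m B) x y = \sum_z ent A x z * ent B z y.
Proof.
by rewrite /ent mxE (reindex_onto enum_rank enum_val) /= => [|i _];
  [apply: eq_bigl => z; rewrite enum_rankK eqxx | rewrite enum_valK].
Qed.

Lemma ent_dag A x y : ent (dag A) x y = (ent A y x)^*.
Proof. by rewrite /ent /dag !mxE. Qed.

Lemma ent_scalar a x y : ent (a%:M) x y = a *+ (x == y) :> C.
Proof. by rewrite /ent mxE (inj_eq enum_rank_inj). Qed.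

Lemma mxtrace_ent A : \tr A = \sum_x ent A x x.
Proof.
by rewrite /mxtrace (reindex_onto enum_rank enum_val) /= => [|i _];
  [apply: eq_bigl => z; rewrite enum_rankK eqxx | rewrite enum_valK].
Qed.

End Entries.

(** * Singular values, trace norm and operator norm *)

Section MatrixNorms.
Variable C : numClosedFieldType.

Lemma dag_mul m n p (A : 'M[C]_(m, n)) (B : 'M[C]_(n, p)) :
  dag (A *m B) = dag B *m dag A.
Proof. by rewrite /dag trmx_mul map_mxM. Qed.

Lemma dagK m n (A : 'M[C]_(m, n)) : dag (dag A) = A.
Proof. exact: trmxCK. Qed.

Lemma dag1 m : dag 1%:M = 1%:M :> 'M[C]_m.
Proof. by rewrite /dag trmx1 map_mx1. Qed.

Lemma unitary_mulmxdag m n (A : 'M[C]_(m, n)) :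
  A \is unitarymx -> A *m dag A = 1%:M.
Proof. exact: unitarymxP. Qed.

Lemma unitary_muldagmx m (A : 'M[C]_m) : A \is unitarymx -> dag A *m A = 1%:M.
Proof. by move=> /unitary_mulmxdag /mulmx1C. Qed.

Lemma unitarymx_dag m (A : 'M[C]_m) : A \is unitarymx -> dag A \is unitarymx.
Proof. by rewrite /dag trmxC_unitary. Qed.

(** Half of a singular value decomposition: the columns of [A *m dag V] are orthogonal, and their
    squared norms are the eigenvalues of [dag A *m A]. *)
Lemma spectral_gram m (A : 'M[C]_m) :
  let V := spectralmx (dag A *m A) in
  dag (A *m dag V) *m (A *m dag V) = diag_mx (spectral_diag (dag A *m A)).
Proof.
move=> V; have Vu : V \is unitarymx by apply: spectral_unitarymx.
have AAn : dag A *m A \is normalmx.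
  by apply/normalmxP; rewrite -/(dag _) dag_mul dagK.
have /orthomx_spectralP e := AAn.
rewrite dag_mul dagK -!mulmxA (mulmxA (dag A)) [in LHS]e -/V.
rewrite invmx_unitary // -/(dag V) !mulmxA unitary_mulmxdag // mul1mx.
by rewrite -mulmxA unitary_mulmxdag // mulmx1.
Qed.

Lemma gram_diagE m n (Y : 'M[C]_(m, n)) i :
  (dag Y *m Y) i i = \sum_j `|Y j i| ^+ 2.
Proof. by rewrite mxE; apply: eq_bigr => j _; rewrite !mxE mulrC normCK. Qed.

Lemma spectral_gram_ge0 m (A : 'M[C]_m) i :
  0 <= spectral_diag (dag A *m A) 0 i.
Proof.
have -> : spectral_diag (dag A *m A) 0 i
  = diag_mx (spectral_diag (dag A *m A)) i i by rewrite mxE eqxx mulr1n.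
rewrite -spectral_gram gram_diagE sumr_ge0 // => j _; exact: exprn_ge0.
Qed.

(* With V diagonalizing X^* X, the columns of Y = X V^* have the singular values
   of X as norms, and tr (X W) = tr (V W Y) pairs them with the rows of the
   unitary V W. *)
Lemma norm_mxtrace_mul_unitary m (X W : 'M[C]_m) :
  W \is unitarymx -> `|\tr (X *m W)| <= trnorm X.
Proof.
move=> Wu; set V := spectralmx (dag X *m X).
have Vu : V \is unitarymx by apply: spectral_unitarymx.
pose Y := X *m dag V; pose Z := V *m W.
have Zu : Z \is unitarymx by apply: mul_unitarymx.
have -> : \tr (X *m W) = \tr (Z *m Y).
  rewrite mxtrace_mulC [in RHS]mxtrace_mulC /Y /Z !mulmxA.
  by rewrite -(mulmxA X) unitary_muldagmx // mulmx1 mxtrace_mulC.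
rewrite /mxtrace (le_trans (ler_norm_sum _ _ _)) // /trnorm ler_sum // => i _.
have -> : (Z *m Y) i i = dotmx (row i Z) (row i (dag Y)).
  rewrite dotmxE !mxE; apply: eq_bigr => j _; rewrite !mxE conjCK //.
have := CauchySchwarz_sqrt (@dotmx C m) (row i Z) (row i (dag Y)).
(* Cauchy-Schwarz comes with its equality case; only the weak inequality is kept. *)
move=> /leifP; set b := ~~ _; move=> H.
have {H b} : `|dotmx (row i Z) (row i (dag Y))| <=
   sqrtC (dotmx (row i Z) (row i Z)) * sqrtC (dotmx (row i (dag Y)) (row i (dag Y))).
  by case: b H => [/eqP -> //|/ltW].
have -> : dotmx (row i Z) (row i Z) = 1.
  have /matrixP/(_ i i) := unitary_mulmxdag Zu; rewrite [RHS]mxE eqxx mulr1n => <-.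
  by rewrite dotmxE !mxE; apply: eq_bigr => j _; rewrite !mxE.
have -> : dotmx (row i (dag Y)) (row i (dag Y))
    = spectral_diag (dag X *m X) 0 i.
  transitivity ((dag Y *m Y) i i); last by rewrite spectral_gram mxE eqxx mulr1n.
  by rewrite dotmxE !mxE; apply: eq_bigr => j _; rewrite !mxE conjCK.
by rewrite sqrtC1 mul1r.
Qed.

(** The order of [C] is partial, so [Num.max] is an upper bound only for comparable arguments.
    Nonnegative numbers are real, hence comparable; the induction therefore carries the sign of the
    running maximum along. *)
Lemma bigmax_nneg_ge (I : eqType) (s : seq I) (F : I -> C) :
  (forall i, 0 <= F i) ->
  0 <= \big[Num.max/0]_(i <- s) F i
  /\ {in s, forall i, F i <= \big[Num.max/0]_(i <- s) F i}.
Proof.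
move=> F0; elim: s => [|j s [M0 IH]]; first by rewrite big_nil; split.
have jM : (F j >=< \big[Num.max/0]_(i <- s) F i)%O.
  by apply: real_comparable; exact: ger0_real.
rewrite big_cons; split=> [|i]; first by rewrite comparable_le_max // M0 orbT.
rewrite inE comparable_le_max // => /predU1P[->|/IH ->]; last exact: orbT.
by rewrite lexx.
Qed.

Lemma opnorm_ge m (A : 'M[C]_m) i :
  sqrtC (spectral_diag (dag A *m A) 0 i) <= opnorm A.
Proof.
have [|_] := @bigmax_nneg_ge _ (index_enum 'I_m)
  (fun i => sqrtC (spectral_diag (dag A *m A) 0 i)).
  by move=> j; rewrite sqrtC_ge0 spectral_gram_ge0.
by apply; rewrite mem_index_enum.
Qed.

Lemma opnorm_ge0 m (A : 'M[C]_m) : 0 <= opnorm A.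
Proof.
case: m A => [A|m A]; first by rewrite /opnorm big_ord0.
by rewrite (le_trans _ (opnorm_ge A 0)) // sqrtC_ge0 spectral_gram_ge0.
Qed.

(** The trace is the sum of the [m] squared singular values, each at most the square of the largest.
    This compares the Hilbert-Schmidt norm with the operator norm. *)
Lemma mxtrace_gram_le m (A : 'M[C]_m) :
  \tr (dag A *m A) <= m%:R * opnorm A ^+ 2.
Proof.
set V := spectralmx (dag A *m A).
have Vu : V \is unitarymx by apply: spectral_unitarymx.
have -> : \tr (dag A *m A) = \sum_i spectral_diag (dag A *m A) 0 i.
  rewrite -mxtrace_diag -spectral_gram -/V dag_mul dagK.
  rewrite [RHS]mxtrace_mulC -mulmxA (mulmxA (dag V)) (unitary_muldagmx Vu).
  by rewrite mul1mx mxtrace_mulC.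
have le i : spectral_diag (dag A *m A) 0 i <= opnorm A ^+ 2.
  rewrite -[leLHS]sqrtCK lerXn2r ?nnegrE ?sqrtC_ge0 ?spectral_gram_ge0 //.
    exact: opnorm_ge0.
  exact: opnorm_ge.
rewrite (le_trans (ler_sum _ (fun i _ => le i))) //.
by rewrite sumr_const card_ord mulr_natl.
Qed.

End MatrixNorms.

(** * Operators acting trivially on a qubit, and embedded two-qubit gates *)

Section Locality.
Variables (C : numClosedFieldType) (n : nat).
Implicit Types (A B : 'M[C]_#|cfg n|) (x y z : cfg n) (q j k : 'I_n).

Definition upd q (b : bool) x : cfg n := [ffun r => if r == q then b else x r].

Lemma upd_id q x : upd q (x q) x = x.
Proof. by apply/ffunP => r; rewrite ffunE; case: eqP => // ->. Qed.

Lemma flip_upd q b x : flip q (upd q b x) = upd q (~~ b) x.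
Proof. by apply/ffunP => r; rewrite !ffunE; case: eqP. Qed.

Lemma upd_upd q b b' x : upd q b (upd q b' x) = upd q b x.
Proof. by apply/ffunP => r; rewrite !ffunE; case: eqP. Qed.

Lemma updC j k a b x : j != k -> upd j a (upd k b x) = upd k b (upd j a x).
Proof.
by move=> jk; apply/ffunP => r; rewrite !ffunE; case: eqP => // ->; case: eqP jk.
Qed.

Lemma flipK q : involutive (flip (n := n) q).
Proof.
by move=> x; apply/ffunP => r; rewrite !ffunE; case: eqP => //; rewrite negbK.
Qed.

Lemma flip_eq q x y : (flip q x q == flip q y q) = (x q == y q).
Proof. by rewrite !ffunE eqxx (inj_eq negb_inj). Qed.

Lemma trivial_onP A q : reflect (forall x y,
    ent A x y = if x q == y q then ent A (flip q x) (flip q y) else 0)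
  (trivial_on A q).
Proof.
by apply: (iffP forallP) => [H x y|H x];
  [have /forallP/(_ y)/eqP := H x | apply/forallP => y; apply/eqP].
Qed.

Lemma trivial_on_ent0 A q x y :
  trivial_on A q -> x q != y q -> ent A x y = 0.
Proof. by move=> /trivial_onP -> /negPf ->. Qed.

Lemma trivial_on_flip A q x y :
  trivial_on A q -> ent A (flip q x) (flip q y) = ent A x y.
Proof.
move=> Aq; case: (eqVneq (x q) (y q)) => xy.
  by move/trivial_onP: Aq => /(_ x y) ->; rewrite xy eqxx.
by rewrite !(trivial_on_ent0 Aq) // flip_eq.
Qed.

(** Two distinct bits are negations of each other, so the two sides differ by a simultaneous
    [flip]. *)
Lemma trivial_on_upd A q b b' x y : trivial_on A q ->
  ent A (upd q b x) (upd q b y) = ent A (upd q b' x) (upd q b' y).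
Proof.
move=> Aq; case: (eqVneq b b') => [-> //|bb'].
have -> : b = ~~ b' by case: b b' bb' => [] [].
by rewrite -!flip_upd trivial_on_flip.
Qed.

Lemma trivial_on_mul A B q :
  trivial_on A q -> trivial_on B q -> trivial_on (A *m B) q.
Proof.
move=> Aq Bq; apply/trivial_onP => x y; rewrite !ent_mul.
case: eqP => [_|/eqP xy].
  rewrite [RHS](reindex_inj (can_inj (flipK q))); apply: eq_bigr => z _.
  by rewrite !trivial_on_flip.
apply: big1 => z _; case: (eqVneq (x q) (z q)) => [xz|/(trivial_on_ent0 Aq) ->].
  by rewrite (trivial_on_ent0 Bq) ?mulr0 // -xz.
by rewrite mul0r.
Qed.

Lemma trivial_on_dag A q : trivial_on A q -> trivial_on (dag A) q.
Proof.
move=> Aq; apply/trivial_onP => x y; rewrite !ent_dag eq_sym.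
case: eqP => [_|/eqP/(trivial_on_ent0 Aq) ->]; first by rewrite trivial_on_flip.
exact: conjC0.
Qed.

Lemma opsupp_subP A (L : {set 'I_n}) :
  reflect (forall q, q \notin L -> trivial_on A q) (opsupp A \subset L).
Proof.
apply: (iffP subsetP) => [H q|H q]; last rewrite inE.
  by apply: contraR => qA; apply: H; rewrite inE.
by apply: contraR => /H.
Qed.

Definition off2 j k x y := [forall q, ((q != j) && (q != k)) ==> (x q == y q)].

Lemma ent_embed2 j k (G : gate C) x y :
  ent (embed2 j k G) x y = (off2 j k x y)%:R * ent G (x j, x k) (y j, y k).
Proof. exact: ent_mxF. Qed.

Lemma off2P j k x y : reflect (x = upd j (x j) (upd k (x k) y)) (off2 j k x y).
Proof.
apply: (iffP forallP) => [H|-> q].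
  apply/ffunP => q; rewrite !ffunE; case: eqP => [->//|/eqP qj].
  case: eqP => [->//|/eqP qk]; apply/eqP; have /implyP := H q.
  by rewrite qj qk => /(_ isT).
by rewrite !ffunE; case: (q == j) => //; case: (q == k) => //=; rewrite eqxx.
Qed.

Lemma off2C j k x y : off2 j k x y = off2 j k y x.
Proof. by apply: eq_forallb => q; rewrite (eq_sym (x q)). Qed.

Lemma off2_upd j k x y a b : off2 j k (upd j a (upd k b x)) y = off2 j k x y.
Proof. by apply: eq_forallb => q; rewrite !ffunE; case: (q == j); case: (q == k). Qed.

(** Only the four configurations that agree with [x] away from [j] and [k] contribute. Products with
    an embedded gate thereby become sums over the index type of the gate. *)
Lemma sum_off2 j k x (F : cfg n -> C) : j != k ->
  \sum_z (off2 j k z x)%:R * F z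
  = \sum_(ab : bool * bool) F (upd j ab.1 (upd k ab.2 x)).
Proof.
move=> jk; rewrite (bigID (fun z => off2 j k z x)) /= addrC big1 ?add0r; last first.
  by move=> z /negPf ->; rewrite mul0r.
rewrite (reindex_onto (fun ab : bool * bool => upd j ab.1 (upd k ab.2 x))
  (fun z => (z j, z k))) /= => [|z /off2P <- //].
apply: eq_big => [[a b]|[a b] _] /=; rewrite off2_upd.
  have kj : (k == j) = false by rewrite eq_sym (negPf jk).
  by rewrite !ffunE !eqxx kj eqxx andbT; apply/forallP => q; rewrite eqxx implybT.
have -> : off2 j k x x by apply/forallP => q; rewrite eqxx implybT.
by rewrite mul1r.
Qed.

(** By [sum_off2], an entry of the product with the adjoint is [off2 j k x y] times an entry of
    [G *m dag G]. *)
Lemma embed2_unitary j k (G : gate C) : j != k ->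
  G \is unitarymx -> embed2 j k G \is unitarymx.
Proof.
move=> jk /unitary_mulmxdag GG; apply/unitarymxP; rewrite -/(dag _).
apply: ent_inj => x y; rewrite ent_mul ent_scalar.
have kj : (k == j) = false by rewrite eq_sym (negPf jk).
under eq_bigr => z _ do
  rewrite ent_dag !ent_embed2 off2C -mulrA.
rewrite sum_off2 //.
under eq_bigr => ab _ do
  rewrite !ffunE !eqxx kj rmorphM /= rmorph_nat (off2C _ _ y) off2_upd mulrCA
          -surjective_pairing -ent_dag.
rewrite -mulr_sumr -ent_mul GG ent_scalar.
case: (eqVneq x y) => [->|xy].
  by rewrite eqxx mulr1; have -> : off2 j k y y by apply/forallP => q; rewrite eqxx implybT.
case: (boolP (off2 j k x y)) => [/off2P xE|]; last by rewrite mul0r.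
case: eqP => [[xj xk]|_]; last by rewrite mulr0.
by case/eqP: xy; rewrite xE xj xk !upd_id.
Qed.

Lemma embed2_trivial j k q (G : gate C) :
  q != j -> q != k -> trivial_on (embed2 j k G) q.
Proof.
move=> qj qk; apply/trivial_onP => x y; rewrite !ent_embed2.
have F z r : q != r -> flip q z r = z r.
  by rewrite eq_sym => /negPf rq; rewrite ffunE rq.
rewrite !F //.
case: eqP => [xy|/eqP xy]; last first.
  have -> : off2 j k x y = false; last by rewrite mul0r.
  by apply/negP => /forallP/(_ q); rewrite qj qk (negPf xy).
congr ((nat_of_bool _)%:R * _); apply: eq_forallb => r.
by case: (eqVneq q r) => [<-|qr]; rewrite ?flip_eq ?F.
Qed.

(** In either product the gate leaves four intermediate configurations, and triviality of [A] on [j]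
    and [k] leaves one of them. The two surviving entries of [A] differ only in the common values on
    [j] and [k], which do not matter. *)
Lemma embed2_comm A j k (G : gate C) : j != k ->
  trivial_on A j -> trivial_on A k -> A *m embed2 j k G = embed2 j k G *m A.
Proof.
move=> jk Aj Ak; apply: ent_inj => x y; rewrite !ent_mul.
have kj : (k == j) = false by rewrite eq_sym (negPf jk).
under eq_bigr => z _ do rewrite ent_embed2 mulrCA.
under [in RHS]eq_bigr => z _ do rewrite ent_embed2 off2C -mulrA.
rewrite !sum_off2 //.
under eq_bigr => ab _ do
  rewrite !ffunE !eqxx kj -surjective_pairing.
under [in RHS]eq_bigr => ab _ do
  rewrite !ffunE !eqxx kj -surjective_pairing.
rewrite (bigD1 (x j, x k)) //= big1 => [|[a b] abx]; last first.
  move: abx; rewrite xpair_eqE negb_and /= => /orP[aj|bk].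
    by rewrite (trivial_on_ent0 Aj) ?mul0r // ffunE eqxx eq_sym.
  by rewrite (trivial_on_ent0 Ak) ?mul0r // !ffunE kj eqxx eq_sym.
rewrite addr0 (bigD1 (y j, y k)) //= big1 => [|[a b] aby]; last first.
  move: aby; rewrite xpair_eqE negb_and /= => /orP[aj|bk].
    by rewrite (trivial_on_ent0 Aj) ?mulr0 // ffunE eqxx.
  by rewrite (trivial_on_ent0 Ak) ?mulr0 // !ffunE kj eqxx.
rewrite addr0 mulrC; congr (_ * _).
(* The common value on [k] is changed first, then the one on [j]. *)
transitivity (ent A (upd k (y k) x) (upd k (y k) (upd j (x j) y))).
  by rewrite (updC _ _ _ jk) -{1}(upd_id k x); exact: trivial_on_upd.
have -> : upd k (y k) x = upd j (x j) (upd k (y k) x) by rewrite updC ?upd_id.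
rewrite -(updC _ _ _ jk) upd_id (trivial_on_upd _ (y j)) //.
by rewrite upd_id upd_upd.
Qed.

(** If both qubits are in [L], all three factors are trivial off [L]. If neither is, [A] commutes
    with the gate, which then cancels against its adjoint. *)
Lemma embed2_conj_opsupp A j k (G : gate C) (L : {set 'I_n}) : j != k ->
  G \is unitarymx -> (j \in L) = (k \in L) -> opsupp A \subset L ->
  opsupp (dag (embed2 j k G) *m A *m embed2 j k G) \subset L.
Proof.
move=> jk Gu jkL /opsupp_subP AL; apply/opsupp_subP => q qL.
have [jL|jL] := boolP (j \in L).
  have qj : q != j by apply: contraNneq qL => ->.
  have qk : q != k by apply: contraNneq qL => ->; rewrite -jkL.
  by rewrite !trivial_on_mul ?trivial_on_dag ?AL ?embed2_trivial.
rewrite -mulmxA embed2_comm ?AL -?jkL // mulmxA.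
by rewrite unitary_muldagmx ?embed2_unitary // mul1mx AL.
Qed.

End Locality.

(** * The backward light cone of the brick circuit *)

Section LightCone.
Variables (n D : nat) (p : bool).

Lemma val_nxt (j : 'I_n) : (j.+1 < n)%N -> nxt j = j.+1 :> nat.
Proof. by rewrite /nxt => jn; case: insubP => [k _ ->|]; rewrite ?jn. Qed.

Lemma nxt_neq (j : 'I_n) : (j.+1 < n)%N -> j != nxt j.
Proof. by move=> jn; rewrite -val_eqE /= val_nxt // neq_ltn ltnSn. Qed.

Section Circuit.
Variables (C : numClosedFieldType) (G : 'I_D -> 'I_n -> gate C).
Hypothesis Gu : forall l j, G l j \is unitarymx.

Lemma unitarymx1 m : 1%:M \is @unitarymx C m m.
Proof. by apply/unitarymxP; rewrite -/(dag _) dag1 mulmx1. Qed.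

Lemma layer_unitary l : layer p G l \is unitarymx.
Proof.
rewrite /layer; elim: (enum _) => [|j s IH] /=; first exact: unitarymx1.
case: ifP => // /andP[jn _].
by rewrite mul_unitarymx // embed2_unitary // nxt_neq.
Qed.

Lemma hea_unitary : hea p G \is unitarymx.
Proof.
rewrite /hea; elim: (enum _) => [|l s IH] /=; first exact: unitarymx1.
by rewrite mul_unitarymx // layer_unitary.
Qed.

(** No gate of layer [l] crosses the boundary of [L]; the guards are those of [layer]. *)
Definition layer_closed (l : nat) (L : {set 'I_n}) :=
  forall j : 'I_n, (j.+1 < n)%N -> ~~ odd (j + l + p) ->
  (j \in L) = (nxt j \in L).

Lemma layer_conj_opsupp (l : 'I_D) A L : layer_closed l L -> opsupp A \subset L ->
  opsupp (dag (layer p G l) *m A *m layer p G l) \subset L.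
Proof.
move=> Lc; rewrite /layer; elim: (enum _) A => [|j s IH] A AL /=.
  by rewrite dag1 mul1mx mulmx1.
case: ifP => [/andP[jn jl]|_]; last exact: IH.
(* The head gate stands leftmost in the product, so it conjugates [A] first; the induction
   hypothesis applies to the resulting operator. *)
rewrite dag_mul !mulmxA -(mulmxA (dag (foldr _ _ _))).
rewrite -(mulmxA (dag (foldr _ _ _))); apply: IH.
by apply: embed2_conj_opsupp; rewrite ?nxt_neq // Lc.
Qed.

(* Backwards in the circuit, the qubit [q] first grows to the pair
   [{b - 1, b}], [b = cone_base q], of the last layer, and each earlier layer
   extends this interval by one qubit on both sides, its pairs having the
   opposite parity. *)
Definition cone_base (q : nat) : nat := q + odd (q + D + p).

(** The interval from [cone_base q - t] to [cone_base q + t - 1], cut to the line; writing the left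
    bound additively avoids truncated subtraction. *)
Definition cone1 (t : nat) (q : 'I_n) : {set 'I_n} :=
  [set r : 'I_n | (cone_base q <= r + t)%N && (r.+1 <= cone_base q + t)%N].

Definition cone (t : nat) (Q : {set 'I_n}) : {set 'I_n} :=
  \bigcup_(q in Q) cone1 t q.

Lemma card_cone1 t q : (#|cone1 t q| <= 2 * t)%N.
Proof.
(* Truncation is harmless here: if [cone_base q < t], the list starts at 0 and its length [2 * t]
   still exceeds every position in the interval. *)
rewrite -(size_iota (cone_base q - t) (2 * t)) cardE -(size_map val).
apply: uniq_leq_size; first by rewrite map_inj_uniq ?enum_uniq //; exact: val_inj.
move=> s /mapP[r]; rewrite mem_enum inE mem_iota => /andP[h1 h2] ->.
by move: h1 h2; move: (cone_base q) => b; rewrite /=; lia.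
Qed.

Lemma card_cone t Q : (#|cone t Q| <= 2 * t * #|Q|)%N.
Proof.
rewrite /cone mulnC -sum_nat_const.
elim/big_ind2: _ => [|a A b B Aa Bb|q _]; first by rewrite cards0.
  by rewrite (leq_trans (leq_card_setU A B)) // leq_add.
exact: card_cone1.
Qed.

Lemma cone_mono t u Q : (t <= u)%N -> cone t Q \subset cone u Q.
Proof.
move=> tu; apply/subsetP => r /bigcupP[q qQ]; rewrite inE => /andP[h1 h2].
by apply/bigcupP; exists q => //; rewrite inE; apply/andP; split; lia.
Qed.

Lemma sub_cone (Q : {set 'I_n}) : Q \subset cone 1 Q.
Proof.
apply/subsetP => q qQ; apply/bigcupP; exists q => //; rewrite inE /cone_base.
by case: odd; lia.
Qed.

(** Since [cone_base q + D + p] is even and [l = D - t], the couplings across the two ends of the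
    interval, starting at [cone_base q - t - 1] and [cone_base q + t - 1], have the wrong parity to
    carry a gate of layer [l]. *)
Lemma cone_closed l t Q : (l + t = D)%N -> layer_closed l (cone t Q).
Proof.
move=> lt j jn jl; have e q : (j \in cone1 t q) = (nxt j \in cone1 t q).
  rewrite !inE val_nxt // /cone_base; move: jl; rewrite -lt.
  by move: (nat_of_ord j) (nat_of_ord q) => a b; lia.
by apply/bigcupP/bigcupP => -[q qQ h]; exists q; rewrite // ?e // -e.
Qed.

Lemma hea_conj_opsupp A : (0 < D)%N ->
  opsupp (dag (hea p G) *m A *m hea p G) \subset cone D (opsupp A).
Proof.
(* [V t] is the product of the last [t] layers, those that act first on an observable in the
   Heisenberg picture. *)
move=> D0; pose V t := foldr (fun l acc => acc *m layer p G l) 1%:M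
  (drop (D - t) (enum 'I_D)).
(* The cone of width 0 is empty, so the induction starts from width 1, and the last layer of the
   circuit costs no further growth. *)
suff H t : (t <= D)%N ->
    opsupp (dag (V t) *m A *m V t) \subset cone (maxn t 1) (opsupp A).
  have := H D (leqnn D); rewrite /V subnn drop0 (maxn_idPl _) //.
elim: t => [|t IH] tD.
  rewrite /V subn0 drop_oversize ?size_enum_ord //=.
  by rewrite dag1 mul1mx mulmx1 sub_cone.
have lD : (D - t.+1 < D)%N by lia.
have -> : V t.+1 = V t *m layer p G (Ordinal lD).
  rewrite /V (drop_nth (Ordinal lD)) ?size_enum_ord //=.
  rewrite (_ : (D - t.+1).+1 = (D - t)%N); last lia.
  by congr (_ *m layer p G _); apply: val_inj; rewrite /= nth_enum_ord.
rewrite dag_mul !mulmxA -(mulmxA (dag (layer _ _ _))).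
rewrite -(mulmxA (dag (layer _ _ _))); apply: layer_conj_opsupp.
  by rewrite (maxn_idPl _) //; apply: cone_closed; rewrite /= subnK.
rewrite (subset_trans (IH _)) ?cone_mono //; lia.
Qed.

Lemma card_opsupp_hea_conj A : (0 < D)%N ->
  (#|opsupp (dag (hea p G) *m A *m hea p G)| <= 2 * D * #|opsupp A|)%N.
Proof.
by move=> D0; rewrite (leq_trans _ (card_cone _ _)) // subset_leq_card // hea_conj_opsupp.
Qed.

End Circuit.
End LightCone.

(** * Reduction to a subset of qubits by the partial trace *)

Section Reduction.
Variables (C : numClosedFieldType) (n : nat) (L : {set 'I_n}).
Implicit Types (A Q : 'M[C]_#|cfg n|) (x y : cfg n) (a b : scfg L).

(** A section of [restr L]; the qubits outside [L] get the default value [false]. *)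
Definition ext a : cfg n := [ffun q => if insub q is Some r then a r else false].

Lemma extE a (q : {q | q \in L}) : ext a (val q) = a q.
Proof. by rewrite ffunE valK. Qed.

Lemma ext_out a q : q \notin L -> ext a q = false.
Proof. by move=> qL; rewrite ffunE insubN. Qed.

Lemma restr_ext : cancel ext (restr L).
Proof. by move=> a; apply/ffunP => q; rewrite ffunE extE. Qed.

Definition agree_off x y := [forall q, (q \notin L) ==> (x q == y q)].

Lemma agree_offP x y : reflect (forall q, q \notin L -> x q = y q) (agree_off x y).
Proof.
apply: (iffP forallP) => [H q qL|H q]; first by have /implyP/(_ qL)/eqP := H q.
by apply/implyP => /H ->.
Qed.

(** As [x] and [y] agree off [L], each reset changes one bit, of the same value, in both arguments,
    and [trivial_on_upd] applies. *)
Lemma ent_clear A (s : seq 'I_n) x y :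
  opsupp A \subset L -> {in s, forall q, q \notin L} -> agree_off x y ->
  let clear := foldl (fun z q => upd q false z) in
  ent A (clear x s) (clear y s) = ent A x y.
Proof.
move=> /opsupp_subP AL; elim: s x y => //= q s IH x y sL xy.
have qL : q \notin L by rewrite sL ?mem_head.
rewrite IH; last 2 first.
- by move=> r rs; rewrite sL // inE rs orbT.
- by apply/agree_offP => r rL; rewrite !ffunE (agree_offP _ _ xy).
rewrite (trivial_on_upd _ (x q)) ?AL // upd_id.
by rewrite (agree_offP _ _ xy) // upd_id.
Qed.

Lemma foldl_upd (s : seq 'I_n) x q :
  foldl (fun z r => upd r false z) x s q = (q \notin s) && x q.
Proof.
elim: s x => //= r s IH x; rewrite IH ffunE inE.
by case: (q == r); case: (q \in s).
Qed.

Lemma clear_restr x :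
  foldl (fun z r => upd r false z) x (enum (~: L)) = ext (restr L x).
Proof.
apply/ffunP => q; rewrite foldl_upd mem_enum inE negbK.
case: (boolP (q \in L)) => qL /=; last by rewrite ext_out.
by rewrite -[q]/(val (exist _ q qL : {q | q \in L})) extE ffunE.
Qed.

Lemma ent_local A x y : opsupp A \subset L ->
  ent A x y = (agree_off x y)%:R * ent A (ext (restr L x)) (ext (restr L y)).
Proof.
move=> AL; case: (boolP (agree_off x y)) => [xy|].
  rewrite mul1r -!clear_restr ent_clear // => q.
  by rewrite mem_enum inE.
rewrite negb_forall => /existsP[q]; rewrite negb_imply => /andP[qL xyq].
by rewrite mul0r; move/opsupp_subP: AL => /(_ q qL)/trivial_on_ent0 ->.
Qed.

(** For [A] supported in [L] this is the tensor factor of [A] on [L], the other factor being the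
    identity; [ent_local] is that factorization. *)
Definition redmx A : 'M[C]_#|scfg L| := mxF (fun a b => ent A (ext a) (ext b)).

Lemma mxtrace_mul_local rho A : opsupp A \subset L ->
  \tr (rho *m A) = \tr (ptrace L rho *m redmx A).
Proof.
move=> AL; rewrite !mxtrace_ent.
under eq_bigr do rewrite ent_mul.
under [in RHS]eq_bigr do rewrite ent_mul.
rewrite !pair_big /=.
under [in RHS]eq_bigr => ab _ do
  rewrite !ent_mxF pair_big mulr_suml.
rewrite exchange_big /=; apply: eq_bigr => -[x y] _ /=.
(* Each pair [x], [y] contributes to exactly one entry of the partial trace. *)
rewrite (bigD1 (restr L x, restr L y)) //= big1 ?addr0 => [|[a b]].
  rewrite !eqxx /= (ent_local _ _ AL) mulrCA -mulrA.
  suff -> : agree_off y x = [forall q, (q \notin L) ==> (x q == y q)] by [].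
  by apply: eq_forallb => q; rewrite eq_sym.
rewrite xpair_eqE => /negPf abx.
by rewrite (eq_sym _ a) (eq_sym _ b) abx !mul0r.
Qed.

Lemma card_restr_fiber a : #|[set x | restr L x == a]| = (2 ^ (n - #|L|))%N.
Proof.
(* The fibre is a product of sets of allowed bits: one bit at each qubit of [L], both bits
   elsewhere. *)
pose F q := if insub q is Some r then pred1 (a r) else [pred _ : bool | true].
rewrite (@eq_card _ _ (family F)) => [|x]; last first.
  rewrite inE; apply/eqP/familyP => [xa q|H].
    by rewrite /F; case: insubP => // r _ <-; rewrite inE -xa ffunE.
  apply/ffunP => q; have := H (val q).
  by rewrite /F valK inE ffunE => /eqP.
rewrite card_family foldrE big_image /= (bigID (mem L)) /= big1 ?mul1n.
  rewrite (eq_bigr (fun=> 2)) => [|q qL].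
    rewrite prod_nat_const; congr (2 ^ _)%N.
    have e : (#|L| + #|[predC L]|)%N = n by rewrite cardC card_ord.
    transitivity #|[predC L]|; last exact: (canRL (addKn _) e).
    by apply: eq_card => q; rewrite !inE.
  by rewrite /F insubN // card_bool.
by move=> q qL; rewrite /F insubT /= card1.
Qed.

Lemma ptrace_scalar1 : ptrace L (1%:M : 'M[C]__) = (2 ^ (n - #|L|))%:R%:M.
Proof.
apply: ent_inj => a b; rewrite ent_mxF ent_scalar.
transitivity (\sum_(x : cfg n) (((restr L x == a) && (restr L x == b))%:R : C)).
  apply: eq_bigr => x _; rewrite (bigD1 x) //= big1 => [|y yx].
    rewrite ent_scalar eqxx mulr1 addr0; congr (nat_of_bool _)%:R.
    by rewrite [X in _ && X](_ : _ = true) ?andbT //; apply/forallP => q; rewrite eqxx implybT.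
  by rewrite ent_scalar (eq_sym x) (negPf yx) mulr0.
case: (eqVneq a b) => [<-|ab].
  rewrite -(card_restr_fiber a) -sum1_card natr_sum mulr1n big_mkcond [RHS]big_mkcond.
  by apply: eq_bigr => x _; rewrite inE andbb; case: eqP.
apply: big1 => x _; case: eqP => //= ->.
by rewrite (negPf ab).
Qed.

(** Between extensions by [false], the intermediate configurations in [Q *m dag Q] must also be
    [false] off [L], so the sum runs over extensions only. *)
Lemma redmx_unitary Q : opsupp Q \subset L ->
  Q \is unitarymx -> redmx Q \is unitarymx.
Proof.
move=> QL /unitary_mulmxdag QQ; apply/unitarymxP; rewrite -/(dag _).
apply: ent_inj => a b; rewrite ent_scalar -(inj_eq (can_inj restr_ext)).
rewrite -ent_scalar -QQ !ent_mul.
rewrite [RHS](bigID (fun z => z == ext (restr L z))) /= addrC [X in _ = X + _]big1 ?add0r.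
  rewrite (reindex_onto ext (restr L)) => [|z /eqP <- //].
  apply: eq_big => [c|c _]; first by rewrite restr_ext !eqxx.
  by rewrite !ent_dag !ent_mxF.
move=> z zL; rewrite (ent_local _ _ QL).
case: (boolP (agree_off _ _)) => [/agree_offP az|]; last by rewrite !mul0r.
case/eqP: zL; apply/ffunP => q; case: (boolP (q \in L)) => qL.
  by rewrite -[q]/(val (exist _ q qL : {q | q \in L})) extE ffunE.
by rewrite -az // !ext_out.
Qed.

Lemma trace_dev_le_infoI rho Q : opsupp Q \subset L -> Q \is unitarymx ->
  `|\tr (rho *m Q) - \tr Q / (2 ^ n)%:R| <= infoI L rho.
Proof.
move=> QL Qu.
have Ln : (#|L| <= n)%N by rewrite -[leqRHS](card_ord n) max_card.
have -> : \tr (rho *m Q) - \tr Q / (2 ^ n)%:R =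
    \tr ((ptrace L rho - ((2 ^ #|L|)%:R)^-1 *: 1%:M) *m redmx Q).
  rewrite mulmxBl mxtraceD (mxtrace_mul_local _ QL) raddfN /=; congr (_ - _).
  (* Inserting the identity as a state gives the trace of [Q] as [2 ^ (n - #|L|)] times that of
     [redmx Q]. *)
  rewrite -{1}(mul1mx Q) (mxtrace_mul_local _ QL) ptrace_scalar1.
  rewrite mul_scalar_mx -scalemxAl mul1mx !mxtraceZ mulrAC.
  congr (_ * _); have -> : (2 ^ n = 2 ^ (n - #|L|) * 2 ^ #|L|)%N.
    by rewrite -expnD subnK.
  by rewrite natrM invfM mulrA divff ?mul1r // pnatr_eq0 expn_eq0.
by apply: norm_mxtrace_mul_unitary; apply: redmx_unitary.
Qed.

End Reduction.

(** * Orthogonality and counting of Pauli strings, and the coefficient bound *)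

Section Paulis.
Variables (C : numClosedFieldType) (n : nat).
Implicit Types P Q : pstring n.

Lemma sum_bool (F : bool -> C) : \sum_b F b = F true + F false.
Proof. by rewrite (bigD1 true) //= (big_pred1 false) // => -[]. Qed.

Lemma sigma_orthogonal (a a' : 'I_4) :
  \sum_(b : bool) \sum_(b' : bool) (sigma C a b' b)^* * sigma C a' b' b
  = 2%:R *+ (a == a').
Proof.
rewrite !sum_bool.
case: a a' => [[|[|[|[|a]]]] ?] [[|[|[|[|a']]]] ?] //; rewrite /sigma /= -?val_eqE /=;
  rewrite ?rmorphN ?rmorph1 ?rmorph0 /= ?conjCi ?mulrNN ?mulNr ?mulrN ?mulCii;
  by ring.
Qed.

Lemma sigma_unitary (a : 'I_4) (b b' : bool) :
  \sum_(d : bool) sigma C a b d * (sigma C a b' d)^* = (b == b')%:R.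
Proof.
rewrite !sum_bool.
case: a => [[|[|[|[|a]]]] ?] //; rewrite /sigma /=; case: b b' => [] [];
  rewrite /= ?rmorphN ?rmorph1 ?rmorph0 /= ?conjCi ?mulrNN ?mulNr ?mulrN ?mulCii;
  by ring.
Qed.

Lemma ent_pauli P (x y : cfg n) :
  ent (pauli C P) x y = \prod_q sigma C (P q) (x q) (y q).
Proof. exact: ent_mxF. Qed.

Lemma pauli_unitary P : pauli C P \is unitarymx.
Proof.
apply/unitarymxP; rewrite -/(dag _); apply: ent_inj => x y.
rewrite ent_mul ent_scalar.
under eq_bigr => z _ do rewrite ent_dag !ent_pauli rmorph_prod -big_split /=.
rewrite -(bigA_distr_bigA (fun q b =>
  sigma C (P q) (x q) b * (sigma C (P q) (y q) b)^*)).
under eq_bigr do rewrite sigma_unitary.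
case: (eqVneq x y) => [->|]; first by rewrite big1 // => q _; rewrite eqxx.
move=> xy; have [q xyq] : exists q, x q != y q.
  apply/existsP; apply: contraNT xy; rewrite negb_exists => /forallP H.
  by apply/eqP/ffunP => q; have := H q; rewrite negbK => /eqP.
by rewrite (bigD1 q) //= (negPf xyq) mul0r.
Qed.

(** Distributing the product over both sums of configurations leaves a product of single-qubit
    Hilbert-Schmidt inner products, one of which vanishes when the strings differ. *)
Lemma pauli_orthogonal P Q :
  \tr (dag (pauli C P) *m pauli C Q) = (2 ^ n)%:R *+ (P == Q).
Proof.
rewrite mxtrace_ent; under eq_bigr => x _.
  rewrite ent_mul; under eq_bigr => z _ do
    rewrite ent_dag !ent_pauli rmorph_prod -big_split /=.
  rewrite -(bigA_distr_bigA (fun q b =>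
    (sigma C (P q) b (x q))^* * sigma C (Q q) b (x q))).
  over.
rewrite -(bigA_distr_bigA (fun q b' => \sum_(b : bool)
    (sigma C (P q) b b')^* * sigma C (Q q) b b')).
under eq_bigr do rewrite sigma_orthogonal.
case: (eqVneq P Q) => [->|].
  under eq_bigr do rewrite eqxx.
  by rewrite prodr_const card_ord natrX.
move=> xy; have [q xyq] : exists q, P q != Q q.
  apply/existsP; apply: contraNT xy; rewrite negb_exists => /forallP H.
  by apply/eqP/ffunP => q; have := H q; rewrite negbK => /eqP.
by rewrite (bigD1 q) //= (negPf xyq) mul0r.
Qed.

Lemma card_cfg : #|cfg n| = (2 ^ n)%N.
Proof. by rewrite card_ffun card_bool card_ord. Qed.

(** Parseval's identity for the Pauli strings; the factor [2 ^ n] is also the dimension in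
    [mxtrace_gram_le] and cancels. *)
Lemma sum_sqr_coeff_le (S : {set pstring n}) (c : pstring n -> C) :
  \sum_(P in S) `|c P| ^+ 2 <= opnorm (\sum_(P in S) c P *: pauli C P) ^+ 2.
Proof.
set O := (X in opnorm X); have := mxtrace_gram_le O.
suff -> : \tr (dag O *m O) = (2 ^ n)%:R * \sum_(P in S) `|c P| ^+ 2.
  have -> : (#|cfg n|%:R : C) = (2 ^ n)%:R by rewrite card_cfg.
  by rewrite ler_pM2l // ltr0n expn_gt0.
rewrite {2}/O mulmx_sumr raddf_sum mulr_sumr; apply: eq_bigr => Q QS.
rewrite -scalemxAr /= mxtraceZ.
rewrite (_ : dag O = \sum_(P in S) (c P)^* *: dag (pauli C P)); last first.
  by rewrite /dag /O !raddf_sum; apply: eq_bigr => P _; rewrite /= linearZ /= map_mxZ.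
rewrite mulmx_suml raddf_sum (bigD1 Q) //= big1 => [|P /andP[_ PQ]].
  rewrite addr0 -scalemxAl /= mxtraceZ pauli_orthogonal eqxx mulr1n.
  by rewrite normCK; ring.
by rewrite -scalemxAl /= mxtraceZ pauli_orthogonal (negPf PQ) mulr0.
Qed.

Lemma nontrivial_on_pauli P q : P q != 0 -> q \in opsupp (pauli C P).
Proof.
apply: contraNT; rewrite inE negbK => /trivial_onP Pq; apply/eqP.
have H b b' : sigma C (P q) b b'
    = if b == b' then sigma C (P q) (~~ b) (~~ b') else 0.
  pose x : cfg n := [ffun r => if r == q then b else false].
  (* Away from [q] the row bit is [false], and the column bit selects the nonzero entry of that row:
     off the diagonal for X and Y, on it for 1 and Z. The other factors can then be cancelled. *)
  pose y : cfg n := [ffun r =>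
    if r == q then b' else (val (P r) == 1)%N || (val (P r) == 2)%N].
  have := Pq x y; rewrite !ent_pauli !(bigD1 q (P := predT)) //= !ffunE !eqxx.
  pose F r := sigma C (P r) (x r) (y r).
  rewrite (eq_bigr F) //.
  have -> : \prod_(r < n | r != q) sigma C (P r) (flip q x r) (flip q y r)
     = \prod_(r < n | r != q) F r.
    by apply: eq_bigr => r /negPf rq; rewrite /F [flip q x r]ffunE [flip q y r]ffunE rq.
  have F0 : \prod_(r < n | r != q) F r != 0.
    apply/prodf_neq0 => r /negPf rq; rewrite /F !ffunE rq /sigma.
    case: (P r) => [[|[|[|[|a]]]] ?] //=; rewrite ?oner_eq0 //.
    by rewrite oppr_eq0 neq0Ci.
  case: ifP => _ e; first exact: (mulIf F0 e).
  by move/eqP: e; rewrite mulf_eq0 (negPf F0) orbF => /eqP.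
(* X and Y have off-diagonal entries, and the diagonal of Z changes sign under the flip. *)
move: H; case: (P q) => [[|[|[|[|a]]]] ai] // H; first exact: val_inj.
- by have /eqP := H true false; rewrite /sigma /= oner_eq0.
- by have /eqP := H true false; rewrite /sigma /= (negPf (neq0Ci _)).
by have /eqP := H true true; rewrite /sigma /= eq_sym -addr_eq0 -mulr2n pnatr_eq0.
Qed.

(** A string of weight at most [k.+1] arises from one of weight at most [k] by overwriting one of
    [n] qubits with one of 4 letters. The side condition excludes [n = 0] with [k > 0], where the
    bound is 0 but the empty string exists. *)
Lemma card_low_weight k : (0 < n)%N || (k == 0)%N ->
  (#|[set P : pstring n | #|[set q | P q != 0%R]| <= k]| <= (4 * n) ^ k)%N.
Proof.
elim: k => [|k IH] nk.
  rewrite expn0; apply: (@leq_trans #|[set ([ffun=> 0] : pstring n)]|); last by rewrite cards1.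
  apply: subset_leq_card.
  apply/subsetP => P; rewrite !inE leqn0 cards_eq0 => /eqP P0.
  apply/eqP/ffunP => q; rewrite ffunE; apply/eqP; move/setP/(_ q): P0.
  by rewrite !inE => /negbFE.
rewrite orbF in nk; have {IH} IH := IH (introT orP (or_introl nk)).
set B := [set P : pstring n | (#|[set q | P q != 0%R]| <= k)%N] in IH.
pose f (u : pstring n * ('I_n * 'I_4)) : pstring n :=
  [ffun r => if r == u.2.1 then u.2.2 else u.1 r].
have sub : [set P : pstring n | (#|[set q | P q != 0%R]| <= k.+1)%N]
   \subset f @: setX B [set: 'I_n * 'I_4].
  apply/subsetP => P; rewrite inE => Pk; apply/imsetP.
  case: (pickP [pred q | P q != 0]) => [q /= Pq|P0].
    exists ([ffun r => if r == q then 0 else P r], (q, P q)).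
      rewrite !inE /= andbT -ltnS; apply: leq_trans Pk; apply: proper_card.
      apply/properP; split; last first.
        by exists q; rewrite !inE ?Pq //= ffunE eqxx negbK.
      by apply/subsetP => r; rewrite !inE ffunE; case: ifP => //; rewrite eqxx.
    by apply/ffunP => r; rewrite !ffunE /=; case: eqP => // ->.
  (* The identity string has no letter to erase; an arbitrary qubit is overwritten by its own
     letter. *)
  pose q : 'I_n := Ordinal nk.
  exists (P, (q, P q)); last by apply/ffunP => r; rewrite ffunE /=; case: eqP => // ->.
  rewrite !inE /= andbT (_ : [set _ | _] = set0) ?cards0 //.
  by apply/setP => r; rewrite !inE; exact: P0.
apply: leq_trans (subset_leq_card sub) _.
rewrite (leq_trans (leq_imset_card _ _)) // cardsX cardsT card_prod !card_ord.
by rewrite expnSr leq_mul // mulnC.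
Qed.

(** Expand the square and bound each product by the mean of the two squares. *)
Lemma sqr_sum_le_card (I : finType) (A : {set I}) (F : I -> C) :
  (forall i, F i \is Num.real) ->
  (\sum_(i in A) F i) ^+ 2 <= #|A|%:R * \sum_(i in A) F i ^+ 2.
Proof.
move=> Fr; rewrite expr2 mulr_suml.
have -> : #|A|%:R * \sum_(i in A) F i ^+ 2
  = \sum_(i in A) \sum_(j in A) (F i ^+ 2 + F j ^+ 2) / 2.
  under [in RHS]eq_bigr => i _ do
    rewrite -mulr_suml big_split /= sumr_const.
  rewrite -mulr_suml big_split /= sumr_const sumrMnl.
  by field.
apply: ler_sum => i _; rewrite mulr_sumr; apply: ler_sum => j _.
exact: real_leif_mean_square.
Qed.

Lemma sum_coeff_le (S : {set pstring n}) (c : pstring n -> C) :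
  \sum_(P in S) `|c P|
  <= (3 * n)%:R ^+ (\max_(P in S) #|opsupp (pauli C P)|)
     * opnorm (\sum_(P in S) c P *: pauli C P).
Proof.
set k := (\max_(P in S) _)%N; set O := (X in opnorm X).
(* This gives [k = 0] when [n = 0], as [card_low_weight] requires. *)
have kn : (k <= n)%N.
  by apply/bigmax_leqP => P _; rewrite (leq_trans (max_card _)) ?card_ord.
have Sk : (#|S| <= ((3 * n) ^ k) ^ 2)%N.
  apply: (@leq_trans ((4 * n) ^ k)).
    apply: leq_trans (card_low_weight _); last by lia.
    apply/subset_leq_card/subsetP => P PS; rewrite inE.
    apply: leq_trans (leq_bigmax_cond _ PS); apply/subset_leq_card/subsetP => q.
    by rewrite inE; apply: nontrivial_on_pauli.
  (* With the exponents exchanged, it remains to see that [4 * n] is at most [(3 * n) ^ 2]. *)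
  rewrite expnAC; case: (posnP k) => [-> //|k0].
  by rewrite leq_exp2r //; nia.
rewrite -(@ler_pXn2r _ 2) ?nnegrE ?sumr_ge0 //; last first.
  by rewrite mulr_ge0 ?opnorm_ge0 ?exprn_ge0.
rewrite (le_trans (sqr_sum_le_card _ _)) //; first by move=> P; exact: normr_real.
rewrite exprMn -!natrX ler_pM ?ler_nat ?sum_sqr_coeff_le ?sumr_ge0 //.
by move=> P _; exact: exprn_ge0.
Qed.

End Paulis.

(** * The bounds for the ansatz *)

Section Ansatz.
Variables (C : numClosedFieldType) (n D : nat) (p : bool).
Variables (G : 'I_D -> 'I_n -> gate C) (S : {set pstring n}).

Lemma hea_concentration (rho : 'M[C]_#|cfg n|) (c : pstring n -> C) :
  (forall l j, G l j \is unitarymx) ->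
  `|\tr (hea p G *m rho *m dag (hea p G) *m (\sum_(P in S) c P *: pauli C P))
    - \tr (\sum_(P in S) c P *: pauli C P) / (2 ^ n)%:R|
  <= \sum_(P in S) `|c P|
       * infoI (opsupp (dag (hea p G) *m pauli C P *m hea p G)) rho.
Proof.
move=> /(hea_unitary p); move: (hea p G) => U Uu.
have UPu P : dag U *m pauli C P *m U \is unitarymx.
  by rewrite !mul_unitarymx ?unitarymx_dag ?pauli_unitary.
set O := \sum_(P in S) c P *: pauli C P.
(* Cyclicity of the trace moves [U] onto each string, and conjugation keeps its trace, so both terms
   concern the same unitary. *)
have -> : \tr (U *m rho *m dag U *m O) - \tr O / (2 ^ n)%:R =
    \sum_(P in S) c P * (\tr (rho *m (dag U *m pauli C P *m U))
      - \tr (dag U *m pauli C P *m U) / (2 ^ n)%:R).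
  rewrite /O mulmx_sumr !raddf_sum mulr_suml -sumrB.
  apply: eq_bigr => P _; rewrite -scalemxAr /= !mxtraceZ mulrBr mulrA.
  have -> : \tr (U *m rho *m dag U *m pauli C P)
      = \tr (rho *m (dag U *m pauli C P *m U)).
    by rewrite -!mulmxA mxtrace_mulC !mulmxA.
  have -> : \tr (dag U *m pauli C P *m U) = \tr (pauli C P).
    by rewrite mxtrace_mulC mulmxA unitary_mulmxdag // mul1mx.
  by [].
apply: le_trans (ler_norm_sum _ _ _) _; apply: ler_sum => P _.
by rewrite normrM ler_wpM2l // trace_dev_le_infoI.
Qed.

Lemma hea_light_cone : (0 < D)%N -> (forall l j, G l j \is unitarymx) ->
  (\max_(P in S) #|opsupp (dag (hea p G) *m pauli C P *m hea p G)|
   <= 2 * D * \max_(P in S) #|opsupp (pauli C P)|)%N.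
Proof.
move=> D0 Gu; apply/bigmax_leqP => P PS.
apply: leq_trans (card_opsupp_hea_conj _ Gu _ D0) _.
by rewrite leq_mul //; apply: leq_trans (leq_bigmax_cond _ PS).
Qed.

End Ansatz.

Theorem theorem1 (R : realType) (n D : nat) (p : bool)
  (G : 'I_D -> 'I_n -> gate R[i])
  (psi : 'cV[R[i]]_#|cfg n|)
  (S : {set pstring n}) (c : pstring n -> R[i]) :
  (0 < D)%N ->
  (forall l j, G l j \is unitarymx) ->
  dag psi *m psi = 1%:M ->
  (forall P, P \in S -> c P \is Num.real) ->
  let U := hea p G in
  let rho := psi *m dag psi in
  let O := \sum_(P in S) c P *: pauli R[i] P in
  let f := \tr (U *m rho *m dag U *m O) in
  let ftrv := \tr O / (2 ^ n)%:R in
  let Lam := fun P => opsupp (dag U *m pauli R[i] P *m U) in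
  let k := (\max_(P in S) #|opsupp (pauli R[i] P)|)%N in
  [/\ `|f - ftrv| <= \sum_(P in S) `|c P| * infoI (Lam P) rho,
      \sum_(P in S) `|c P| <= (3 * n)%:R ^+ k * opnorm O
    & (\max_(P in S) #|Lam P| <= 2 * D * k)%N].
Proof.
move=> D0 Gu _ _ U rho O f ftrv Lam k; split.
- exact: hea_concentration.
- exact: sum_coeff_le.
- exact: hea_light_cone.
Qed.
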